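(* Let $\mathcal{P}_n$ be the set of separated partitions of $[n]$ and $\mathcal{RSP}(n)$ the set of run-sorted permutations of $[n]$. Define $\theta:\mathcal{P}_n\to\mathcal{RSP}(n)$ as follows. For $P=B_1/\cdots/B_k\in\mathcal{P}_n$ in block representation, call an element $b\in B_i$ with $2\le i\le k$ movable if $b\ne\min(B_i)$ and $b-1\in B_j$ for some $j<i$. Form new blocks $C_1,\dots,C_k$ where $C_i$ consists of the non-movable elements of $B_i$ together with the movable elements of $B_{i+1}$ (with $B_{k+1}=\emptyset$), each $C_i$ arranged in increasing order; then $\theta(P)$ is the concatenation $C_1C_2\cdots C_k$. Then $\theta$ is a bijection.
   Context: A set partition of $[n]$ in block representation $B_1/\cdots/B_k$ has blocks ordered by increasing minima. It is separated if no two consecutive integers $b,b+1$ lie in the same block. A permutation of $[n]$ is run-sorted if it is the concatenation of the blocks (each in increasing order) of a set partition of $[n]$ in block representation; equivalently the minima of its successive runs (maximal increasing factors) are increasing. (In the paper, $\theta$ is described as processing $i=2,\dots,k$ in order and moving each movable $b\in B_i$ to block $i-1$, then flattening; this is the same map.) *)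

(* Defs.v *)
From mathcomp Require Import all_boot all_fingroup.
Set Implicit Arguments.
Unset Strict Implicit.
Unset Printing Implicit Defensive.

(* The ground set [n] = {1, ..., n} is encoded as 'I_n: the ordinal i stands
   for the integer i + 1.  Block indices are likewise 0-based: block P i is
   the block B_(i+1) of the block representation. *)

Definition set_partition n (P : {set {set 'I_n}}) : bool :=
  partition P [set: 'I_n].

Definition separated n (P : {set {set 'I_n}}) : bool :=
  [forall B in P, forall a in B, forall b in B, (b : nat) != a.+1].

(* The default value n is only returned on the empty set. *)
Definition block_min n (B : {set 'I_n}) : nat :=
  \big[minn/n]_(b in B) (b : nat).

Definition increasing_word n (B : {set 'I_n}) : seq 'I_n :=
  sort (fun a b : 'I_n => a <= b) (enum B).

Definition block_representation n (P : {set {set 'I_n}}) : seq {set 'I_n} :=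
  sort (fun A B : {set 'I_n} => block_min A <= block_min B) (enum P).

(* Out-of-range indices give the empty set, so B_(k+1) is empty. *)
Definition block n (P : {set {set 'I_n}}) (i : nat) : {set 'I_n} :=
  nth set0 (block_representation P) i.

Definition one_line n (s : 'S_n) : seq 'I_n := [seq s i | i <- enum 'I_n].

Definition run_sorted n (s : 'S_n) : bool :=
  [exists P : {set {set 'I_n}}, set_partition P &&
    (one_line s ==
       flatten [seq increasing_word B | B <- block_representation P])].

Definition movable n (P : {set {set 'I_n}}) (i : nat) (b : 'I_n) : bool :=
  [&& 0 < i, b \in block P i, (b : nat) != block_min (block P i) &
      [exists j : 'I_i, exists a in block P j, a.+1 == (b : nat)]].

Definition new_block n (P : {set {set 'I_n}}) (i : nat) : {set 'I_n} :=
  [set b in block P i | ~~ movable P i b] :|: [set b | movable P i.+1 b].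

Definition theta_word n (P : {set {set 'I_n}}) : seq 'I_n :=
  flatten [seq increasing_word (new_block P i) | i <- iota 0 #|P|].

Definition separated_partitions n : Type :=
  {P : {set {set 'I_n}} | set_partition P && separated P}.

Definition run_sorted_perms n : Type := {s : 'S_n | run_sorted s}.

(* Main.v *)
(** A partition in block representation is the restricted growth function [f]
sending each element to the index of its block. On these functions theta is
local: [C x] is [B x] or [B x - 1], depending on a comparison with [B (x - 1)].
The new blocks [C] keep the minima of the old ones, and separation makes every
non-minimal element of [C_i] exceed the minimum of [C_(i+1)] ("tight"). Hence
the block minima are exactly the right-to-left minima of the word, so a tight
[C] can be read off its word, and [B] is recovered from [C] by increasing [x].
Conversely, splitting a run-sorted word at all its right-to-left minima yields
a tight [C]. Words are compared through the lexicographic order on [(f x, x)],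
which is the order of appearance in the word of [f]. *)

Require Import Defs.
From mathcomp Require Import all_boot all_fingroup.
From mathcomp Require Import zify.
Set Implicit Arguments.
Unset Strict Implicit.
Unset Printing Implicit Defensive.

(** * Restricted growth functions and first occurrences *)

(* Only the values of [f] below [n] matter; in this range [f] is a restricted
   growth function: first occurrences of the values come in increasing order. *)
Definition rgf (n : nat) (f : nat -> nat) : Prop :=
  forall x i, x < n -> i < f x -> exists2 y, y < x & f y = i.

Definition is_first (f : nat -> nat) (x : nat) : bool :=
  f x \notin [seq f y | y <- iota 0 x].

Lemma is_firstP f x : reflect (forall y, y < x -> f y <> f x) (is_first f x).
Proof.
apply: (iffP idP) => [H y yx E|H].
  by case/negP: H; rewrite -E; apply: map_f; rewrite mem_iota.
by apply/mapP => -[y]; rewrite mem_iota /= => /H yx E; apply: yx.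
Qed.

Lemma not_firstP f x : reflect (exists2 y, y < x & f y = f x) (~~ is_first f x).
Proof.
rewrite negbK; apply: (iffP mapP) => -[y]; rewrite ?mem_iota /= => yx E.
  by exists y.
by exists y; rewrite ?mem_iota.
Qed.

Lemma first_occurrence f x : exists y, [/\ y <= x, is_first f y & f y = f x].
Proof.
elim/ltn_ind: x => x IH.
have [fx|/not_firstP [y yx E]] := boolP (is_first f x); first by exists x.
by have [z [zy fz Ez]] := IH y yx; exists z; split; [lia| |lia].
Qed.

Lemma earlier_first f x : ~~ is_first f x ->
  exists y, [/\ y < x, is_first f y & f y = f x].
Proof.
case/not_firstP=> y yx E; have [z [zy fz Ez]] := first_occurrence f y.
by exists z; split; [lia| |lia].
Qed.

Lemma rgf_first n f x i : rgf n f -> x < n -> i < f x ->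
  exists y, [/\ y < x, is_first f y & f y = i].
Proof.
move=> rf xn ix; have [y yx E] := rf x i xn ix.
by have [z [zy fz Ez]] := first_occurrence f y; exists z; split; [lia| |lia].
Qed.

(** An earlier value above [f x] would, by restricted growth, force the value [f x] itself to occur
    before [x]. *)
Lemma rgf_lt_first n f x y : rgf n f -> x < n -> is_first f x -> y < x ->
  f y < f x.
Proof.
move=> rf xn /is_firstP fx yx; rewrite ltnNge leq_eqVlt; apply/negP => /orP[/eqP E|lt].
  by apply: (fx y yx).
have [|z zy E] := rf y (f x) _ lt; first by lia.
by apply: (fx z); first lia.
Qed.

(** If [f x < g x], restricted growth makes [g] take the value [f x] first at some [y < x]; by
    induction [f y = g y = f x], so [x] is not first for [f]. *)
Lemma rgf_eq_on_first n f g : rgf n f -> rgf n g ->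
  (forall x, x < n -> is_first f x = is_first g x) ->
  forall x, x < n -> is_first f x -> f x = g x.
Proof.
move=> rf rg E; elim/ltn_ind => x IH xn fx.
have gx : is_first g x by rewrite -E.
have [lt|lt|//] := ltngtP (f x) (g x).
  have [y [yx gy Ey]] := rgf_first rg xn lt.
  have yn : y < n by lia.
  have fy : is_first f y by rewrite E.
  by case: (is_firstP _ _ fx y yx); rewrite IH.
have [y [yx fy Ey]] := rgf_first rf xn lt.
by case: (is_firstP _ _ gx y yx); rewrite -IH //; lia.
Qed.

(** First occurrences depend only on the kernel, and restricted growth fixes the values there: this
    is the uniqueness of the block representation. *)
Lemma rgf_eq_kernel n f g : rgf n f -> rgf n g ->
  (forall x y, x < n -> y < n -> (f x == f y) = (g x == g y)) ->
  forall x, x < n -> f x = g x.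
Proof.
move=> rf rg K x xn.
have [y [yx fy E]] := first_occurrence f x.
have yn : y < n by lia.
have Eg : g y = g x by apply/eqP; rewrite -K // E.
rewrite -E -Eg; apply: (rgf_eq_on_first rf rg) => // z zn.
apply/is_firstP/is_firstP => H t tz /eqP.
  by rewrite -K; [move/eqP; apply: H|lia|].
by rewrite K; [move/eqP; apply: H|lia|].
Qed.

(** * Theta and its inverse on restricted growth functions *)

Definition slex (f : nat -> nat) (x y : nat) : bool :=
  (f x < f y) || ((f x == f y) && (x < y)).

Definition separated_fun (n : nat) (f : nat -> nat) : Prop :=
  forall x, x.+1 < n -> f x <> f x.+1.

Definition tight (n : nat) (g : nat -> nat) : Prop :=
  forall x, x < n -> ~~ is_first g x -> exists2 y, y < x & g y = (g x).+1.

(** Since [0] is always a first occurrence, the truncated [x.-1] matters only for [x > 0]. *)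
Definition theta_fun (f : nat -> nat) (x : nat) : nat :=
  if is_first f x then f x else if f x.-1 < f x then (f x).-1 else f x.

(** Let [f] be the function to recover. A moved [x] has [f x.-1 < f x = (g x).+1], hence
    [f x.-1 <= g x]; an unmoved non-minimal [x] has [g x = f x < f x.-1] by separation. Comparing
    [g x] with the value already recovered at [x.-1] tells the two apart. *)
Fixpoint theta_inv_fun (g : nat -> nat) (x : nat) : nat :=
  match x with
  | 0 => g 0
  | y.+1 => if is_first g y.+1 then g y.+1
            else if g y.+1 < theta_inv_fun g y then g y.+1 else (g y.+1).+1
  end.

Lemma theta_fun_le f x : theta_fun f x <= f x.
Proof. by rewrite /theta_fun; do 2! case: ifP => // _; lia. Qed.

Lemma theta_fun_first f x : is_first f x -> theta_fun f x = f x.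
Proof. by rewrite /theta_fun => ->. Qed.

(** Theta never raises a value, so a first occurrence stays above everything before it. Any other
    [x] receives [f x] or [(f x).-1], a value taken at an earlier first occurrence, which theta
    fixes. *)
Lemma is_first_theta_fun n f x : rgf n f -> x < n ->
  is_first (theta_fun f) x = is_first f x.
Proof.
move=> rf xn; apply/idP/idP => H; last first.
  apply/is_firstP => y yx; rewrite (theta_fun_first H) => E.
  by have := rgf_lt_first rf xn H yx; have := theta_fun_le f y; lia.
apply: contraLR H => nfx.
have [z [zx fz Ez]] : exists z, [/\ z < x, is_first f z & f z = theta_fun f x].
  rewrite /theta_fun (negbTE nfx); case: ifP => lt; last exact: earlier_first.
  by apply: (rgf_first rf xn); lia.
by apply/not_firstP; exists z; rewrite // theta_fun_first.
Qed.

Lemma rgf_theta_fun n f : rgf n f -> rgf n (theta_fun f).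
Proof.
move=> rf x i xn ix; have [|y [yx fy E]] := @rgf_first n f x i rf xn.
  by have := theta_fun_le f x; lia.
by exists y; rewrite // theta_fun_first.
Qed.

(** For a moved [x] the wanted value is [f x] itself, which occurred earlier. For an unmoved one
    separation gives [(f x).+1 <= f x.-1], and restricted growth provides that value at or before
    [x.-1]. *)
Lemma tight_theta_fun n f : rgf n f -> separated_fun n f -> tight n (theta_fun f).
Proof.
move=> rf sf x xn; rewrite (is_first_theta_fun rf) // => nfx.
have x0 : 0 < x by case/not_firstP: nfx => y; lia.
have sx : f x.-1 <> f x by rewrite -{2}(prednK x0); apply: sf; lia.
suff [z [zx fz Ez]] : exists z, [/\ z < x, is_first f z & f z = (theta_fun f x).+1].
  by exists z; rewrite // theta_fun_first.
rewrite /theta_fun (negbTE nfx); case: ifP => lt.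
  by rewrite prednK; [exact: earlier_first|lia].
have := @rgf_first n f x.-1 (f x).+1 rf; case: (ltnP (f x).+1 (f x.-1)) => lt'.
  by case=> // [|z [zx fz Ez]]; [lia|exists z; split=> //; lia].
move=> _; have [z [zx fz Ez]] := first_occurrence f x.-1.
by exists z; split=> //; lia.
Qed.

(** By induction the value [c] at the predecessor is common. If [x] were moved under [f] only, then
    [f' x = (f x).-1] and separation would give [(f x).-1 < c < f x]. *)
Lemma theta_fun_inj n f f' : rgf n f -> rgf n f' ->
  separated_fun n f -> separated_fun n f' ->
  (forall x, x < n -> theta_fun f x = theta_fun f' x) ->
  forall x, x < n -> f x = f' x.
Proof.
move=> rf rf' sf sf' E.
have F x : x < n -> is_first f x = is_first f' x.
  move=> xn; rewrite -(is_first_theta_fun rf) // -(is_first_theta_fun rf') //.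
  by apply/is_firstP/is_firstP => H y yx; have := H y yx; rewrite !E //; lia.
elim=> [|x IH] xn; first by have := E 0 xn.
have := E _ xn; rewrite /theta_fun -F //=; case: ifP => // _.
have := sf _ xn; have := sf' _ xn; rewrite -IH; last by lia.
by do 2! case: ifP; lia.
Qed.

Section ThetaInv.
Variables (n : nat) (g : nat -> nat).
Hypotheses (rg : rgf n g) (tg : tight n g).

Lemma theta_inv_fun_first x : is_first g x -> theta_inv_fun g x = g x.
Proof. by case: x => //= x ->. Qed.

(** Tightness enters here: a value raised to [(g x).+1] has already been taken by [g] before [x]. *)
Lemma theta_inv_fun_attained x : x < n ->
  exists y, [/\ y <= x, is_first g y & g y = theta_inv_fun g x].
Proof.
case: x => [|x] xn /=; first by exists 0.
case: ifP => [fx|/negbT nfx]; first by exists x.+1.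
case: ifP => _; first by exact: first_occurrence.
have [y yx <-] := tg xn nfx.
by have [z [zy fz Ez]] := first_occurrence g y; exists z; split=> //; lia.
Qed.

Lemma theta_inv_fun_lt_first x y : x < n -> is_first g x -> y < x ->
  theta_inv_fun g y < g x.
Proof.
move=> xn fx yx; have [|z [zy fz <-]] := @theta_inv_fun_attained y; first by lia.
by apply: (rgf_lt_first rg) => //; lia.
Qed.

Lemma is_first_theta_inv_fun x : x < n ->
  is_first (theta_inv_fun g) x = is_first g x.
Proof.
move=> xn; apply/idP/idP => H; last first.
  apply/is_firstP => y yx; rewrite (theta_inv_fun_first H).
  by have := theta_inv_fun_lt_first xn H yx; lia.
apply: contraLR H => nfx; have [y [yx fy E]] := theta_inv_fun_attained xn.
apply/not_firstP; exists y; last by rewrite theta_inv_fun_first.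
by case: ltngtP yx => // Exy _; move: nfx; rewrite -Exy fy.
Qed.

Lemma rgf_theta_inv_fun : rgf n (theta_inv_fun g).
Proof.
move=> x i xn; have [y [yx fy <-]] := theta_inv_fun_attained xn => iy.
have [|z [zy fz E]] := @rgf_first n g y i rg _ iy; first by lia.
by exists z; [lia|rewrite theta_inv_fun_first].
Qed.

Lemma separated_theta_inv_fun : separated_fun n (theta_inv_fun g).
Proof.
move=> x xn /=; case: ifP => fx; last by case: ifP; lia.
by have := theta_inv_fun_lt_first xn fx (ltnSn x); lia.
Qed.

Lemma theta_inv_funK x : x < n -> theta_fun (theta_inv_fun g) x = g x.
Proof.
move=> xn; rewrite /theta_fun is_first_theta_inv_fun //.
case: ifP => fx; first by rewrite theta_inv_fun_first.
case: x xn fx => //= x xn ->.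
by case: (ltnP (g x.+1) (theta_inv_fun g x)) => H; case: ifP; lia.
Qed.

End ThetaInv.

(** * A tight function is determined by its word *)

(** The condition on [slex] says that [x] is a right-to-left minimum of the word. A non-first [x] is
    not one, since tightness puts a smaller [y] in the next block. *)
Lemma tight_firstP n g x : rgf n g -> tight n g -> x < n ->
  reflect (forall y, y < x -> ~~ slex g x y) (is_first g x).
Proof.
move=> rg tg xn; apply: (iffP idP) => [fx y yx|H].
  by have := rgf_lt_first rg xn fx yx; rewrite /slex; lia.
apply: contraT => /(tg x xn) [y yx E].
by have := H y yx; rewrite /slex E ltnSn.
Qed.

Lemma tight_eq_slex n g g' : rgf n g -> rgf n g' -> tight n g -> tight n g' ->
  (forall x y, x < n -> y < n -> slex g x y = slex g' x y) ->
  forall x, x < n -> g x = g' x.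
Proof.
have le f f' : rgf n f -> rgf n f' -> tight n f -> tight n f' ->
    (forall x y, x < n -> y < n -> slex f x y = slex f' x y) ->
    forall x, x < n -> f x <= f' x.
  move=> rf rf' tf tf' E x xn.
  have F z : z < n -> is_first f z = is_first f' z.
    move=> zn; apply/(tight_firstP rf tf zn)/(tight_firstP rf' tf' zn) => H y yz.
      by rewrite -E ?H //; lia.
    by rewrite E ?H //; lia.
  (* The least element [z] of the block of [x] either is [x] or precedes it in both words, so
     [f x = f z = f' z <= f' x]. *)
  have [z [zx fz Ez]] := first_occurrence f x.
  have zn : z < n by lia.
  have Ef := rgf_eq_on_first rf rf' F zn fz.
  have [Ezx|ne] := eqVneq z x; first by rewrite -Ezx Ef.
  have : slex f' z x by rewrite -E // /slex Ez; lia.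
  by rewrite /slex -Ef; lia.
move=> rg rg' tg tg' E x xn; apply/eqP; rewrite eqn_leq.
by apply/andP; split; apply: le => // y z yn zn; rewrite E.
Qed.

(** * Splitting a word at its right-to-left minima *)

(* [m] is a right-to-left minimum of the word of [h] iff [h m] is a weak
   left-to-right maximum of [h]. *)
Definition weak_record (h : nat -> nat) (m : nat) : bool :=
  all (fun y => h y <= h m) (iota 0 m).

Lemma weak_recordP h m :
  reflect (forall y, y < m -> h y <= h m) (weak_record h m).
Proof.
apply: (iffP allP) => H y yx; first by apply: H; rewrite mem_iota.
by apply: H; move: yx; rewrite mem_iota.
Qed.

(* The number of right-to-left minima at or before [x] in the word of [h], other
   than [0]; such a minimum [m] necessarily satisfies [m <= x]. *)
Definition tighten (h : nat -> nat) (x : nat) : nat :=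
  count (fun m => weak_record h m && (h m <= h x)) (iota 1 x).

(** The count grows by at most one per step, so every intermediate value is reached, and reached at
    a counted point. *)
Lemma count_iota_attained (a : pred nat) i x : i < count a (iota 1 x) ->
  exists m, [/\ 0 < m <= x, a m & count a (iota 1 m) = i.+1].
Proof.
have S y : count a (iota 1 y.+1) = count a (iota 1 y) + a y.+1.
  by rewrite -[in LHS](addn1 y) iotaD count_cat /= add1n addn0.
elim: x => // x IH; rewrite S => ix.
have [/IH [m [mx am E]]|le] := ltnP i (count a (iota 1 x)).
  by exists m; split=> //; lia.
have ax : a x.+1 by case: (a _) ix => //; lia.
exists x.+1; split=> //; first by lia.
by rewrite S; lia.
Qed.

Lemma rgf_tighten n h : rgf n (tighten h).
Proof.
move=> x i xn; case: i => [|i] ix.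
  by exists 0 => //; case: x ix {xn}.
have [m [/andP[m0 mx] /andP[/weak_recordP Mm hm] E]] :
  exists m, [/\ 0 < m <= x, weak_record h m && (h m <= h x) &
    count (fun m => weak_record h m && (h m <= h x)) (iota 1 m) = i.+1].
  by apply: count_iota_attained; apply: ltnW.
(* As [m] is a weak record, every [y <= m] has [h y <= h m <= h x], so up to [m] the counts for [m]
   and for [x] agree. *)
exists m.
  by case: ltngtP mx => // Emx _; move: ix; rewrite /tighten -Emx {1}Emx E ltnn.
rewrite /tighten -E; apply: eq_in_count => y; rewrite mem_iota add1n ltnS => /andP[_ ym].
have : h y <= h m by case: ltngtP ym => // [/Mm //|->].
by move=> hy; rewrite hy (leq_trans hy hm).
Qed.

(** Over a common range, counts at different points can be compared by inclusion of predicates. *)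
Lemma tighten_widen h x b : x <= b ->
  tighten h x = count (fun m => [&& weak_record h m, m <= x & h m <= h x]) (iota 1 b).
Proof.
move=> xb; rewrite -(subnKC xb) iotaD count_cat.
rewrite [X in _ + X](@eq_in_count _ _ pred0) ?count_pred0 ?addn0.
  by apply: eq_in_count => y; rewrite mem_iota add1n ltnS => /andP[_ ->].
move=> y; rewrite mem_iota => /andP[yx _] /=.
have /negbTE-> : ~~ (y <= x) by lia.
by rewrite andbF.
Qed.

Lemma sub_count_lt (T : eqType) (a b : pred T) (s : seq T) z :
  subpred a b -> z \in s -> ~~ a z -> b z -> count a s < count b s.
Proof.
move=> sub zs naz bz.
have le : count (predU a (pred1 z)) s <= count b s.
  by apply: sub_count => y /orP[/sub//|/eqP->].
have I0 : count (predI a (pred1 z)) s = 0.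
  rewrite (@eq_count _ _ pred0) ?count_pred0 // => y /=.
  by case: eqP => [->|]; rewrite ?andbF // (negbTE naz).
have : 0 < count (pred1 z) s by rewrite -has_count has_pred1.
by have := count_predUI a (pred1 z) s; lia.
Qed.

(** A minimum [m] counted for [x] is counted for [y]: if [y < m <= x], then [h y <= h m <= h x]
    would place [y] before [x]. When [x < y] this weak inequality of counts suffices. *)
Lemma slex_tighten_imp n h x y : rgf n h -> x < n -> y < n ->
  slex h x y -> slex (tighten h) x y.
Proof.
move=> rh xn yn lxy.
rewrite /slex (tighten_widen h (ltnW xn)) (tighten_widen h (ltnW yn)).
set a := fun m => _; set b := fun m => _.
have sub m : a m -> b m.
  case/and3P=> /weak_recordP Mm mx hm; rewrite /b; apply/and3P; split.
  - exact/weak_recordP.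
  - have [//|ym] := leqP m y; have := Mm y ym.
    by move: lxy; rewrite /slex; lia.
  - by move: lxy; rewrite /slex; lia.
have le : count a (iota 1 n) <= count b (iota 1 n) by apply: sub_count.
have [xy|yx] := ltnP x y; first by rewrite andbT orbC -leq_eqVlt.
have hxy : h x < h y by move: lxy; rewrite /slex; lia.
(* For strictness: the least element [z] of the block of [y] is a minimum counted for [y], but not
   for [x] because [h x < h z]. *)
have [z [zy fz Ez]] := first_occurrence h y.
have bz : b z.
  apply/and3P; split; rewrite ?Ez //; apply/weak_recordP => t tz.
  by apply: ltnW; apply: (rgf_lt_first rh) => //; lia.
have naz : ~~ a z by rewrite /a; lia.
(* The count leaves out [0]; restricted growth forces [h 0 = 0], whereas [h z > h x]. *)
have z0 : 0 < z.
  case: z Ez {zy fz bz naz} => // E0; have h0 : 0 < h 0 by lia.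
  by have [|t] := rh 0 0 _ h0; first lia.
apply/orP; left; apply: (sub_count_lt sub _ naz bz).
by rewrite mem_iota; lia.
Qed.

(** Both orders are strict and total, so one implication yields the equivalence. *)
Lemma slex_tighten n h x y : rgf n h -> x < n -> y < n ->
  slex (tighten h) x y = slex h x y.
Proof.
move=> rh xn yn; apply/idP/idP => [lxy|]; last exact: (slex_tighten_imp rh).
apply: contraT => nh.
have [Exy|nxy] := eqVneq x y; first by move: lxy; rewrite /slex Exy; lia.
have : slex (tighten h) y x.
  by apply: (slex_tighten_imp rh) => //; move: nh nxy; rewrite /slex; lia.
by move: lxy; rewrite /slex; lia.
Qed.

(** All that is counted for an earlier [y] is counted for [x], and [x] itself is counted only for
    [x]. *)
Lemma weak_record_is_first h x : weak_record h x -> is_first (tighten h) x.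
Proof.
move=> Mx; apply/is_firstP => y yx /eqP; apply/negP; rewrite neq_ltn; apply/orP; left.
rewrite (tighten_widen h (ltnW yx)) (tighten_widen h (leqnn x)).
apply: (@sub_count_lt _ _ _ _ x).
- move=> m /and3P[Mm my hm]; apply/and3P; split=> //; first by lia.
  by move/weak_recordP: Mx => /(_ y yx); lia.
- by rewrite mem_iota; lia.
- by rewrite [x <= y]leqNgt yx /= andbF.
- by rewrite Mx !leqnn.
Qed.

(** A non-first [x] is no weak record, so some smaller [y] follows it in the word. As the order is
    preserved, [y] has a larger [tighten] value than [x], and restricted growth yields the next
    value at or before [y]. *)
Lemma tight_tighten n h : rgf n h -> tight n (tighten h).
Proof.
move=> rh x xn; case: (boolP (weak_record h x)) => [/weak_record_is_first->//|Mx _].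
have [y yx hxy] : exists2 y, y < x & h x < h y.
  case/allPn: Mx => y; rewrite mem_iota -ltnNge => /andP[_ yx] hxy.
  by exists y.
have yn : y < n by lia.
have : slex (tighten h) x y by rewrite (slex_tighten rh) // /slex hxy.
rewrite /slex [x < y]ltnNge (ltnW yx) andbF orbF => lt.
have [Ey|ne] := eqVneq (tighten h y) (tighten h x).+1; first by exists y.
have [|z zy Ez] := @rgf_tighten n h y (tighten h x).+1 yn; first by lia.
by exists z => //; lia.
Qed.

(** * Words read off level sets *)

Definition level n (f : nat -> nat) (i : nat) : {set 'I_n} :=
  [set x : 'I_n | f x == i].

Definition level_word n (f : nat -> nat) (k : nat) : seq 'I_n :=
  flatten [seq increasing_word (level n f i) | i <- iota 0 k].

Lemma mem_increasing_word n (B : {set 'I_n}) : increasing_word B =i B.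
Proof. by move=> x; rewrite mem_sort mem_enum. Qed.

Lemma increasing_word_pairwise n (B : {set 'I_n}) :
  pairwise (fun x y : 'I_n => x < y) (increasing_word B).
Proof.
have tr : transitive (fun x y : 'I_n => x < y) by move=> ? ? ?; apply: ltn_trans.
rewrite -sorted_pairwise //.
rewrite -[sorted _ _](@sorted_map _ _ (@nat_of_ord n) ltn) ltn_sorted_uniq_leq.
rewrite (map_inj_uniq val_inj) sort_uniq enum_uniq /= sorted_map.
by apply: sort_sorted => x y; apply: leq_total.
Qed.

Lemma slex_trans n f : transitive (relpre (@nat_of_ord n) (slex f)).
Proof. by move=> y x z /=; rewrite /slex; lia. Qed.

Lemma slex_irr n f : irreflexive (relpre (@nat_of_ord n) (slex f)).
Proof. by move=> x /=; rewrite /slex; lia. Qed.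

Lemma mem_level_word n f k (x : 'I_n) : (x \in level_word n f k) = (f x < k).
Proof.
apply/flatten_mapP/idP => [[i]|fx].
  by rewrite mem_iota mem_increasing_word inE => ik /eqP->.
by exists (f x); rewrite ?mem_iota // mem_increasing_word inE.
Qed.

Lemma level_word_sorted n f k :
  sorted (relpre (@nat_of_ord n) (slex f)) (level_word n f k).
Proof.
rewrite sorted_pairwise; last exact: slex_trans.
elim: k => // k IH; rewrite /level_word -addn1 iotaD map_cat flatten_cat.
rewrite pairwise_cat -/(level_word n f k) IH /= cats0 add0n; apply/andP; split.
  apply/allrelP => x y; rewrite mem_level_word mem_increasing_word inE => fx /eqP fy.
  by rewrite /= /slex fy fx.
apply: (sub_in_pairwise (P := mem (level n f k))) (increasing_word_pairwise _).
- by move=> x y; rewrite !inE => /eqP fx /eqP fy lt; rewrite /= /slex fx fy lt eqxx orbT.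
- by apply/allP => x; rewrite mem_increasing_word.
Qed.

Lemma level_word_uniq n f k : uniq (level_word n f k).
Proof. exact: sorted_uniq (@slex_trans n f) (@slex_irr n f) _ (level_word_sorted n f k). Qed.

(** A strictly sorted list is determined by its elements; the bounds [k] and [l], possibly
    different, ensure that all of ['I_n] is listed. *)
Lemma eq_level_word n f g k l :
  (forall x, x < n -> f x < k) -> (forall x, x < n -> g x < l) ->
  (forall x y, x < n -> y < n -> slex f x y = slex g x y) ->
  level_word n f k = level_word n g l.
Proof.
move=> fk gl E; apply: (irr_sorted_eq (@slex_trans n f) (@slex_irr n f)).
- exact: level_word_sorted.
- have E' : relpre (@nat_of_ord n) (slex f) =2 relpre (@nat_of_ord n) (slex g).
    by move=> x y /=; apply: E.
  by rewrite (eq_sorted E') level_word_sorted.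
- by move=> x; rewrite !mem_level_word fk ?gl.
Qed.

Lemma level_word_slex n f g k l :
  (forall x, x < n -> f x < k) -> level_word n f k = level_word n g l ->
  forall x y, x < n -> y < n -> slex f x y = slex g x y.
Proof.
move=> fk E.
have imp f1 f2 k1 k2 : (forall x, x < n -> f1 x < k1) ->
    level_word n f1 k1 = level_word n f2 k2 ->
    forall x y, x < n -> y < n -> slex f1 x y -> slex f2 x y.
  move=> b1 E12 x y xn yn lxy; pose ox := Ordinal xn; pose oy := Ordinal yn.
  pose w := level_word n f1 k1.
  have mx : ox \in w by rewrite mem_level_word b1.
  have my : oy \in w by rewrite mem_level_word b1.
  have [lt|gt|Ei] := ltngtP (index ox w) (index oy w).
  - have := sorted_ltn_index (@slex_trans n f2) (level_word_sorted n f2 k2).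
    by move/(_ ox oy); rewrite -E12; apply.
  - have := sorted_ltn_index (@slex_trans n f1) (level_word_sorted n f1 k1) _ _ my mx gt.
    by move: lxy; rewrite /= /slex; lia.
  - have := index_inj ox mx my Ei; case=> Exy.
    by move: lxy; rewrite Exy /slex; lia.
(* The bound on [g] is read off the common word, which contains every element of ['I_n]. *)
have gl x : x < n -> g x < l.
  by move=> xn; rewrite -[x]/(val (Ordinal xn)) -mem_level_word -E mem_level_word fk.
by move=> x y xn yn; apply/idP/idP; [apply: (imp f g k l)|apply: (imp g f l k)].
Qed.

Lemma perm_of_level_word n f k : (forall x, x < n -> f x < k) ->
  exists s : 'S_n, one_line s = level_word n f k.
Proof.
move=> fk; set w := level_word n f k.
have Sw : size w = n.
  rewrite -[RHS](size_enum_ord n); apply/perm_size/uniq_perm.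
  - exact: level_word_uniq.
  - exact: enum_uniq.
  - by move=> x; rewrite mem_level_word fk // mem_enum.
have inj : injective (fun i : 'I_n => nth i w i).
  move=> i j; rewrite (set_nth_default i j) ?Sw // => /eqP.
  by rewrite nth_uniq ?Sw ?level_word_uniq // => /eqP/val_inj.
exists (perm inj).
(* The default [ord0] requires a nonempty ground set, so [n = 0] is treated apart. *)
case: n @w Sw inj => [|n] w Sw inj in fk *.
  by rewrite [RHS](size0nil Sw) /one_line; apply: size0nil; rewrite size_map size_enum_ord.
apply: (@eq_from_nth _ ord0); first by rewrite size_map size_enum_ord.
rewrite size_map size_enum_ord => i lt.
rewrite (nth_map ord0) ?size_enum_ord // permE (nth_enum_ord ord0) //.
by apply: set_nth_default; rewrite Sw.
Qed.

Lemma one_line_inj n : injective (@one_line n).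
Proof.
by move=> s t E; apply/permP => i; move/eq_in_map: E; apply; rewrite mem_enum.
Qed.

(** * Set partitions and their block index functions *)

Lemma block_min_le n (B : {set 'I_n}) (b : 'I_n) : b \in B -> block_min B <= b.
Proof.
rewrite /block_min => bB; move: (mem_index_enum b).
elim: (index_enum _) => // a s IH; rewrite inE big_cons => /predU1P[<-|/IH le].
  by rewrite bB geq_minl.
by case: ifP => // _; rewrite geq_min le orbT.
Qed.

Lemma block_min_attained n (B : {set 'I_n}) : B != set0 ->
  exists2 m : 'I_n, m \in B & block_min B = m.
Proof.
case/set0Pn=> b bB; case: (arg_minnP (fun x : 'I_n => x : nat) bB) => m mB le.
exists m => //; apply/eqP; rewrite eqn_leq block_min_le //=.
by apply: (big_ind (leq m)) => [|x y|x xB]; [exact: ltnW|rewrite leq_min => -> ->|exact: le].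
Qed.

(* Defined on [nat]; the value at [x >= n] is irrelevant. *)
Definition block_index n (P : {set {set 'I_n}}) (x : nat) : nat :=
  find (fun B : {set 'I_n} => [exists y in B, val y == x]) (block_representation P).

Section BlockIndex.
Variables (n : nat) (P : {set {set 'I_n}}).
Hypothesis partP : set_partition P.

Let cover_all (x : 'I_n) : x \in cover P.
Proof. by rewrite (cover_partition partP) inE. Qed.

Let triv : trivIset P.
Proof. by case/and3P: partP. Qed.

Let size_rep : size (block_representation P) = #|P|.
Proof. by rewrite size_sort cardE. Qed.

Let block_in i : i < #|P| -> block P i \in P.
Proof.
by rewrite -size_rep => /(mem_nth set0); rewrite mem_sort mem_enum.
Qed.

Let block_neq0 i : i < #|P| -> block P i != set0.
Proof.
by move/block_in => H; apply: contraTneq H => ->; case/and3P: partP.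
Qed.

Let block_index_in (x : 'I_n) :
  block_index P x < #|P| /\ x \in block P (block_index P x).
Proof.
have H : has (fun B : {set 'I_n} => [exists y in B, val y == x])
             (block_representation P).
  apply/hasP; exists (pblock P x).
    by rewrite mem_sort mem_enum pblock_mem.
  by apply/existsP; exists x; rewrite mem_pblock cover_all eqxx.
split; first by rewrite -size_rep -has_find.
by have /existsP[y /andP[yB /eqP/val_inj E]] := nth_find set0 H; rewrite -{1}E.
Qed.

Lemma block_index_lt x : x < n -> block_index P x < #|P|.
Proof. by move=> xn; have [] := block_index_in (Ordinal xn). Qed.

Lemma mem_block (x : 'I_n) i : (x \in block P i) = (block_index P x == i).
Proof.
have [ltx xB] := block_index_in x.
apply/idP/eqP => [xi|<-//].
have ik : i < #|P|.
  rewrite ltnNge; apply/negP => le.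
  by move: xi; rewrite /block nth_default ?size_rep ?inE.
have E : block P (block_index P x) = block P i.
  by rewrite -(def_pblock triv (block_in ltx) xB) -(def_pblock triv (block_in ik) xi).
apply/eqP; rewrite -(nth_uniq set0 (s := block_representation P)) ?size_rep //.
  exact/eqP.
by rewrite sort_uniq enum_uniq.
Qed.

Lemma block_level i : block P i = level n (block_index P) i.
Proof. by apply/setP => x; rewrite mem_block inE. Qed.

Lemma block_index_attained i : i < #|P| -> exists2 m : 'I_n,
  block_index P m = i & block_min (block P i) = m.
Proof.
move/block_neq0/block_min_attained => [m mB E].
by exists m => //; apply/eqP; rewrite -mem_block.
Qed.

Lemma block_min_mono i j : i <= j -> j < #|P| ->
  block_min (block P i) <= block_min (block P j).
Proof.
rewrite -size_rep => ij jk.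
have tr : transitive (fun A B : {set 'I_n} => block_min A <= block_min B).
  by move=> ? ? ?; apply: leq_trans.
apply: (sorted_leq_nth tr) => //.
- by apply: sort_sorted => A B; apply: leq_total.
- by rewrite inE; apply: leq_ltn_trans jk.
Qed.

(** The minimum of an earlier block is at most that of the block of [x], hence at most [x]; it
    differs from [x], which lies in another block. *)
Lemma rgf_block_index : rgf n (block_index P).
Proof.
move=> x i xn ix; have xk := block_index_lt xn.
have [|m Em Ei] := @block_index_attained i; first by apply: ltn_trans xk.
exists m => //.
have : block_min (block P (block_index P x)) <= x.
  by rewrite -[x in _ <= x]/(val (Ordinal xn)) block_min_le // mem_block.
have := block_min_mono (ltnW ix) xk; rewrite Ei => le1 le2.
rewrite ltn_neqAle (leq_trans le1 le2) andbT; apply/eqP => Emx.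
by move: ix; rewrite -Em Emx ltnn.
Qed.

Lemma is_first_block_index (x : 'I_n) :
  is_first (block_index P) x = (val x == block_min (block P (block_index P x))).
Proof.
have xk := block_index_lt (ltn_ord x).
have [m Em Ei] := block_index_attained xk.
have mx : m <= x by rewrite -Ei block_min_le // mem_block.
rewrite Ei; apply/is_firstP/eqP => [H|-> y yx E].
  by case: ltngtP mx => // lt _; case: (H m lt).
have yn : y < n by apply: ltn_trans yx _.
have : block_min (block P (block_index P x)) <= Ordinal yn.
  by apply: block_min_le; rewrite mem_block /= E Em.
by rewrite Ei leqNgt yx.
Qed.

Lemma movableE i (b : 'I_n) : movable P i b =
  [&& block_index P b == i, ~~ is_first (block_index P) b & block_index P b.-1 < i].
Proof.
rewrite /movable mem_block; case: (block_index P b =P i) => [Ei|]; last by rewrite andbF.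
rewrite is_first_block_index Ei /=.
case: (boolP (val b == _)) => [|nb]; rewrite /= ?andbF //.
(* A non-minimal [b] has a smaller element in its block, so [b.-1] is a genuine predecessor. *)
have b0 : 0 < b.
  have := is_first_block_index b; rewrite Ei (negbTE nb) => /negbT/not_firstP[y].
  by move=> yb _; apply: leq_ltn_trans yb.
have bn : b.-1 < n by rewrite prednK // ltnW.
apply/andP/idP => [[_ /existsP[j /existsP[a /andP[aj /eqP<-]]]]|lt].
  by move: aj; rewrite mem_block /= => /eqP->.
split; first by apply: leq_ltn_trans lt.
apply/existsP; exists (Ordinal lt); apply/existsP; exists (Ordinal bn).
by rewrite mem_block /= prednK // !eqxx.
Qed.

Lemma new_block_level i : new_block P i = level n (theta_fun (block_index P)) i.
Proof.
apply/setP => b; rewrite !inE mem_block !movableE /theta_fun.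
case: (is_first _ b); rewrite /= ?andbF ?andbT ?orbF //.
by case: (ltnP (block_index P b.-1) (block_index P b)) => lt; lia.
Qed.

Lemma theta_word_level :
  theta_word P = level_word n (theta_fun (block_index P)) #|P|.
Proof.
by congr flatten; apply: eq_map => i; rewrite new_block_level.
Qed.

Lemma flatten_blocks_level :
  flatten [seq increasing_word B | B <- block_representation P] =
  level_word n (block_index P) #|P|.
Proof.
rewrite -[block_representation P]take_size -(map_nth_iota0 set0) // size_rep.
rewrite -map_comp; congr flatten; apply: eq_map => i /=.
by rewrite -block_level.
Qed.

Lemma separated_block_index :
  reflect (separated_fun n (block_index P)) (separated P).
Proof.
apply: (iffP idP) => [sP x xn E|sf].
  have xn' := ltnW xn.
  have ltx := block_index_lt xn'.
  move/forall_inP: sP => /(_ _ (block_in ltx)) /forall_inP /(_ (Ordinal xn')).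
  rewrite mem_block /= => /(_ (eqxx _)) /forall_inP /(_ (Ordinal xn)).
  by rewrite mem_block /= -E eqxx => /(_ isT)/eqP.
apply/forall_inP => B BP; apply/forall_inP => a aB; apply/forall_inP => b bB.
apply/eqP => E.
have BE : B = block P (block_index P a).
  have [lta aB'] := block_index_in a.
  by rewrite -(def_pblock triv BP aB) -(def_pblock triv (block_in lta) aB').
apply: (sf a); first by rewrite -E.
by move: bB; rewrite BE mem_block -E => /eqP.
Qed.

Lemma block_index_pblock (x y : 'I_n) :
  (block_index P x == block_index P y) = (y \in pblock P x).
Proof.
have [lt xB] := block_index_in x.
by rewrite (def_pblock triv (block_in lt) xB) mem_block eq_sym.
Qed.

Lemma partition_levels :
  P = [set level n (block_index P) (block_index P x) | x : 'I_n].
Proof.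
apply/setP => B; apply/idP/imsetP => [BP|[x _ ->]].
  have /set0Pn[x xB] : B != set0.
    by apply: contraTneq BP => ->; case/and3P: partP.
  exists x => //; rewrite -block_level.
  have [lt xB'] := block_index_in x.
  by rewrite -(def_pblock triv BP xB) -(def_pblock triv (block_in lt) xB').
by have [lt _] := block_index_in x; rewrite -block_level block_in.
Qed.

End BlockIndex.

Lemma block_index_inj n (P Q : {set {set 'I_n}}) :
  set_partition P -> set_partition Q ->
  (forall x, x < n -> block_index P x = block_index Q x) -> P = Q.
Proof.
move=> pP pQ E; rewrite (partition_levels pP) (partition_levels pQ).
apply: eq_imset => x; apply/setP => y; rewrite !inE !E //.
Qed.

(** The fibres of [f] form a partition whose block index has the same kernel as [f], so the two
    functions agree. *)
Lemma rgf_partition n f : rgf n f ->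
  exists2 P : {set {set 'I_n}}, set_partition P &
    forall x, x < n -> block_index P x = f x.
Proof.
move=> rf; pose P := preim_partition (fun x : 'I_n => f x) [set: 'I_n].
have pP : set_partition P by apply: preim_partitionP.
exists P => //; apply: rgf_eq_kernel => //; first exact: rgf_block_index.
move=> x y xn yn.
have := block_index_pblock pP (Ordinal xn) (Ordinal yn); rewrite /= => ->.
rewrite pblock_equivalence_partition ?inE //.
by move=> a b c _ _ _; split=> //= /eqP ->.
Qed.

(** * Theta on set partitions *)

Lemma eq_theta_fun n f g : (forall x, x < n -> f x = g x) ->
  forall x, x < n -> theta_fun f x = theta_fun g x.
Proof.
move=> E x xn; rewrite /theta_fun !E //; last by lia.
suff -> : is_first f x = is_first g x by [].
apply/is_firstP/is_firstP => H y yx; have := H y yx; rewrite !E //; lia.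
Qed.

Lemma theta_word_run_sorted n (P : {set {set 'I_n}}) : set_partition P ->
  exists2 s : 'S_n, run_sorted s & one_line s = theta_word P.
Proof.
move=> pP.
have lt x : x < n -> theta_fun (block_index P) x < #|P|.
  by move=> xn; apply: leq_ltn_trans (theta_fun_le _ _) (block_index_lt pP xn).
have [s Es] := perm_of_level_word lt.
exists s; last by rewrite theta_word_level.
(* Theta preserves restricted growth, so the new blocks are those of a partition [Q], which
   witnesses run-sortedness. *)
have [Q pQ EQ] := rgf_partition (rgf_theta_fun (rgf_block_index pP)).
apply/existsP; exists Q; rewrite pQ /= Es flatten_blocks_level //.
apply/eqP; apply: eq_level_word => // [x|x y xn yn]; first exact: block_index_lt.
by rewrite /slex !EQ.
Qed.

(** The word determines the order, the order determines the tight function, and the latter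
    determines the block index. *)
Lemma theta_word_inj n (P Q : {set {set 'I_n}}) :
  set_partition P -> set_partition Q -> separated P -> separated Q ->
  theta_word P = theta_word Q -> P = Q.
Proof.
move=> pP pQ /(separated_block_index pP) sP /(separated_block_index pQ) sQ.
have rP := rgf_block_index pP; have rQ := rgf_block_index pQ.
rewrite !theta_word_level // => E.
apply: block_index_inj => //; apply: theta_fun_inj => //.
apply: tight_eq_slex; try exact: rgf_theta_fun; try exact: tight_theta_fun.
apply: level_word_slex E => x xn.
exact: leq_ltn_trans (theta_fun_le _ _) (block_index_lt pP xn).
Qed.

Lemma theta_word_surj n (s : 'S_n) : run_sorted s ->
  exists P : {set {set 'I_n}}, [/\ set_partition P, separated P &
    theta_word P = one_line s].
Proof.
case/existsP=> Q /andP[pQ /eqP ->].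
have rQ := rgf_block_index pQ; set h := block_index Q in rQ.
(* [Q] may fail to be tight; [tighten h] has the same word and admits the inverse recursion. *)
have rg := @rgf_tighten n h; have tg := tight_tighten rQ.
have [P pP EP] := rgf_partition (rgf_theta_inv_fun rg tg).
exists P; split=> //.
  apply/(separated_block_index pP) => x xn; rewrite !EP //; last exact: ltnW.
  exact: separated_theta_inv_fun xn.
rewrite theta_word_level // flatten_blocks_level //.
apply: eq_level_word => [x xn|x xn|x y xn yn].
- exact: leq_ltn_trans (theta_fun_le _ _) (block_index_lt pP xn).
- exact: block_index_lt.
- rewrite -(slex_tighten rQ) // /slex !(eq_theta_fun EP) //.
  by rewrite !(theta_inv_funK rg tg).
Qed.

Theorem theorem35 (n : nat) :
  exists theta : separated_partitions n -> run_sorted_perms n,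
    (forall P : separated_partitions n,
        one_line (sval (theta P)) = theta_word (sval P)) /\
    bijective theta.
Proof.
have ex (P : {P : {set {set 'I_n}} | set_partition P && separated P}) :
    exists t : run_sorted_perms n, one_line (sval t) = theta_word (sval P).
  case: P => P /= /andP[/theta_word_run_sorted [s rs Es] _].
  by exists (exist _ s rs).
(* The domain is finite, so pointwise existence yields a function without any choice axiom. *)
have [theta thetaE] := fin_all_exists ex.
have surj (t : {s : 'S_n | run_sorted s}) :
    exists P : separated_partitions n, theta P = t.
  have [P [pP sP E]] := theta_word_surj (svalP t).
  have pPsP : set_partition P && separated P by rewrite pP.
  exists (exist _ P pPsP); apply: val_inj; apply: one_line_inj.
  by rewrite -[LHS]/(one_line (sval _)) thetaE.
have [eta etaE] := fin_all_exists surj.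
exists theta; split=> //; exists eta => // P.
apply: val_inj; move: (etaE (theta P)) => /(congr1 (fun t => one_line (sval t))).
case/andP: (svalP P) => pP sP; case/andP: (svalP (eta (theta P))) => pQ sQ.
by rewrite !thetaE; apply: theta_word_inj.
Qed.
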